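(* Let $N\geq 1$ and suppose that $\Phi$ belongs either to $C(\mathbb{R}_{+}^{N})\cap C^{2}(\mathbb{R}_{++}^{N})$ or to $C^{2}(\mathbb{R}^{N})$ (real-valued functions). If $\Phi$ is strongly subadditive on $\mathbb{R}_{+}^{N}$, then $\Phi$ is submodular on $\mathbb{R}_{+}^{N}$. Respectively, if $\Phi$ is strongly superadditive on $\mathbb{R}_{+}^{N}$, then $\Phi$ is supermodular on $\mathbb{R}_{+}^{N}$.
   Context: $\mathbb{R}_{+}^{N}=\{\mathbf{x}\in\mathbb{R}^{N}:x_{k}\geq 0 \text{ for all }k\}$ and $\mathbb{R}_{++}^{N}=\{\mathbf{x}\in\mathbb{R}^{N}:x_{k}>0 \text{ for all }k\}$. $C(\mathbb{R}_{+}^{N})\cap C^{2}(\mathbb{R}_{++}^{N})$ is the set of functions continuous on $\mathbb{R}_{+}^{N}$ and twice continuously differentiable on $\mathbb{R}_{++}^{N}$. A function $\Phi$ is strongly subadditive on $\mathbb{R}_{+}^{N}$ if $\Phi(\mathbf{x}+\mathbf{y})\leq\Phi(\mathbf{x})+\Phi(\mathbf{y})$ for all $\mathbf{x},\mathbf{y}\in\mathbb{R}_{+}^{N}$ and $\Phi(\mathbf{x}+\mathbf{y}+\mathbf{z})+\Phi(\mathbf{z})\leq\Phi(\mathbf{x}+\mathbf{z})+\Phi(\mathbf{y}+\mathbf{z})$ for all $\mathbf{x},\mathbf{y},\mathbf{z}\in\mathbb{R}_{+}^{N}$; it is strongly superadditive if $-\Phi$ is strongly subadditive. $\Phi$ is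 submodular on $\mathbb{R}_{+}^{N}$ if $\Phi(\mathbf{x}\vee\mathbf{y})+\Phi(\mathbf{x}\wedge\mathbf{y})\leq\Phi(\mathbf{x})+\Phi(\mathbf{y})$ for all $\mathbf{x},\mathbf{y}\in\mathbb{R}_{+}^{N}$, where $\mathbf{x}\vee\mathbf{y}$ and $\mathbf{x}\wedge\mathbf{y}$ are the coordinatewise maximum and minimum; it is supermodular if $-\Phi$ is submodular. *)

(* Defs.v *)
From mathcomp Require Import all_boot all_order all_algebra.
From mathcomp Require Import all_classical all_reals all_analysis.

Set Implicit Arguments.
Unset Strict Implicit.
Unset Printing Implicit Defensive.

Import Order.TTheory GRing.Theory Num.Theory.
Import numFieldNormedType.Exports.

Local Open Scope classical_set_scope.
Local Open Scope ring_scope.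

(* A function given only on the closed orthant is represented by an arbitrary
   total extension to 'rV[R]_N: the sub/superadditivity and sub/supermodularity
   conditions below only evaluate it on the closed orthant. *)

Definition nneg_orthant {R : realType} {N : nat} : set 'rV[R]_N :=
  [set x | forall k, 0 <= x 0 k].

Definition pos_orthant {R : realType} {N : nat} : set 'rV[R]_N :=
  [set x | forall k, 0 < x 0 k].

(* All iterated partial derivatives of f of order at most k exist and are
   continuous on U.  This is meant for open U only, in which case it involves
   just the values of f on U: 'D_e f x and continuity at x are local at x. *)
Fixpoint Ck_on {R : realType} {N : nat} (k : nat) (U : set 'rV[R]_N)
    (f : 'rV[R]_N -> R) : Prop :=
  (forall x, U x -> {for x, continuous f}) /\
  (if k is k'.+1 then
     forall i : 'I_N,
       (forall x, U x -> derivable f x (delta_mx 0 i)) /\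
       Ck_on k' U ('D_(delta_mx 0 i) f)
   else True).

Definition strongly_subadditive {R : realType} {N : nat}
    (Phi : 'rV[R]_N -> R) : Prop :=
  (forall x y, nneg_orthant x -> nneg_orthant y ->
     Phi (x + y) <= Phi x + Phi y) /\
  (forall x y z, nneg_orthant x -> nneg_orthant y -> nneg_orthant z ->
     Phi (x + y + z) + Phi z <= Phi (x + z) + Phi (y + z)).

Definition strongly_superadditive {R : realType} {N : nat}
    (Phi : 'rV[R]_N -> R) : Prop :=
  strongly_subadditive (fun x => - Phi x).

Definition vmax {R : realType} {N : nat} (x y : 'rV[R]_N) : 'rV[R]_N :=
  \row_k Num.max (x 0 k) (y 0 k).

Definition vmin {R : realType} {N : nat} (x y : 'rV[R]_N) : 'rV[R]_N :=
  \row_k Num.min (x 0 k) (y 0 k).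

Definition submodular {R : realType} {N : nat} (Phi : 'rV[R]_N -> R) : Prop :=
  forall x y, nneg_orthant x -> nneg_orthant y ->
    Phi (vmax x y) + Phi (vmin x y) <= Phi x + Phi y.

Definition supermodular {R : realType} {N : nat} (Phi : 'rV[R]_N -> R) : Prop :=
  submodular (fun x => - Phi x).

(* Main.v *)
(* Apply the second inequality of strong subadditivity to the increments
   [x - vmin x y] and [y - vmin x y] over the base point [vmin x y]: their
   total over that base point is [vmax x y]. *)

Require Import Defs.
From mathcomp Require Import all_boot all_order all_algebra.
From mathcomp Require Import all_classical all_reals all_analysis.

Import Order.TTheory GRing.Theory Num.Theory.
Import numFieldNormedType.Exports.

Local Open Scope classical_set_scope.
Local Open Scope ring_scope.

(** The points [vmin x y], [x], [y], [vmax x y] are the vertices of a parallelogram whose sides at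
    [vmin x y] are nonnegative, because max + min = sum in each coordinate. On such parallelograms,
    the increment inequality is exactly submodularity. *)

Lemma vmax_vmin (R : realType) (N : nat) (x y : 'rV[R]_N) :
  vmax x y = (x - vmin x y) + (y - vmin x y) + vmin x y.
Proof.
apply/rowP => k; rewrite !mxE addrA subrK addrAC.
by rewrite -(addr_max_min (x 0 k) (y 0 k)) addrK.
Qed.

Lemma strongly_subadditive_submodular (R : realType) (N : nat)
    (Phi : 'rV[R]_N -> R) :
  strongly_subadditive Phi -> submodular Phi.
Proof.
move=> [_ Phi_incr] x y x_ge0 y_ge0.
have dx_ge0 : nneg_orthant (x - vmin x y).
  by move=> k; rewrite !mxE subr_ge0 ge_min lexx.
have dy_ge0 : nneg_orthant (y - vmin x y).
  by move=> k; rewrite !mxE subr_ge0 ge_min lexx orbT.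
have min_ge0 : nneg_orthant (vmin x y).
  by move=> k; rewrite mxE le_min x_ge0 y_ge0.
have := Phi_incr _ _ _ dx_ge0 dy_ge0 min_ge0.
by rewrite -vmax_vmin !subrK.
Qed.

Theorem corollary5 (R : realType) (N : nat) (hN : (1 <= N)%N)
    (Phi : 'rV[R]_N -> R)
    (hPhi : ({within nneg_orthant, continuous Phi} /\ Ck_on 2 pos_orthant Phi)
            \/ Ck_on 2 setT Phi) :
  (strongly_subadditive Phi -> submodular Phi) /\
  (strongly_superadditive Phi -> supermodular Phi).
(* Both super-notions unfold to the sub-notions of [fun x => - Phi x], so the same lemma gives both
   halves. *)
Proof. by split; apply: strongly_subadditive_submodular. Qed.
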